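(* Let $K\subset\mathbb{R}^n$ ($n\ge 2$) be a compact set. For every $z\in K$, the harmonic measure $\omega_K(z,\cdot)$ with barycenter at $z$ is concentrated on the fine boundary $\partial_f K$.
   Context: The fine topology on $\mathbb{R}^n$ is the coarsest topology making all subharmonic functions continuous as functions into $[-\infty,\infty]$. $\partial_f K$ is the boundary of $K$ in the fine topology. A measure $\mu$ on $K$ is concentrated on a set $E$ if $\mu(F)=0$ for every (measurable) set $F\subset K\setminus E$; a probability measure is concentrated on $E$ if and only if $\mu(E)=1$. Harmonic measure on $K$: a bounded open set $U$ is regular if for every $f\in C(\partial U)$ there is $h_f\in C(\overline U)$ harmonic on $U$ with $h_f=f$ on $\partial U$; for $z\in U$, $\omega_U(z,\cdot)$ is the Radon probability measure on $\partial U$ with $h_f(z)=\int_{\partial U} f\,d\omega_U(z,\cdot)$ for all $f\in C(\partial U)$. A sequence $\{U_j\}$ of regular open sets containing $K$ with $\overline{U}_{j+1}\subset U_j$ for all $j$ converges to $K$ if for every $\varepsilon>0$ there is $j_0$ such that $U_j$ lies in the $\varepsilon$-neighborhood of $K$ for $j\ge j_0$. Such sequences exist. For $z\in K$, $\omega_K(z,\cdot)$ is the weak$^*$ limit of $\omega_{U_j}(z,\cdot)$; the limit exists and does not depend on the choice of the sequence. *)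

(* Defs.v *)
From HB Require Import structures.
From mathcomp Require Export all_boot all_order all_algebra.
From mathcomp Require Export all_classical all_reals all_analysis.
Export numFieldNormedType.Exports.

Set Implicit Arguments.
Unset Strict Implicit.
Unset Printing Implicit Defensive.

Import Order.TTheory GRing.Theory Num.Theory.

Local Open Scope classical_set_scope.
Local Open Scope ring_scope.

(* R^n is the type 'rV[R]_n. Its library norm is the sup norm; only notions
   that do not depend on the choice of a norm are derived from it below. *)

Definition boundary (T : topologicalType) (A : set T) : set T :=
  closure A `\` interior A.

(* A finite Borel measure on R^n is automatically Radon, so Radon probability
   measures are probability measures on this measurable space. *)
Definition borel_rV (R : realType) (n : nat) :=
  g_sigma_algebraType (@open 'rV[R]_n).

Definition unit_rV (R : realType) (n : nat) (i : 'I_n) : 'rV[R]_n :=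
  delta_mx 0 i.

(* To be used for U open: existence and continuity on U of all second-order
   partial derivatives then amount to h being of class C^2 on U. *)
Definition harmonic_on (R : realType) (n : nat) (U : set 'rV[R]_n)
    (h : 'rV[R]_n -> R) : Prop :=
  forall x, U x ->
  [/\ forall i, derivable h x (unit_rV R i),
      forall i j, derivable ('D_(unit_rV R i) h) x (unit_rV R j),
      forall i j, {for x, continuous ('D_(unit_rV R j) ('D_(unit_rV R i) h))} &
      \sum_(i < n) 'D_(unit_rV R i) ('D_(unit_rV R i) h) x = 0].

(* Subharmonicity on all of R^n, in the sense of F. Riesz: upper
   semicontinuous with values in [-oo, +oo[, and dominated by every harmonic
   function that dominates it on the boundary. The function -oo is allowed;
   being constant, it has no effect on the fine topology. *)
Definition subharmonic (R : realType) (n : nat) (u : 'rV[R]_n -> \bar R) :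
    Prop :=
  [/\ forall x, (u x < +oo)%E,
      lower_semicontinuous (fun x => - u x)%E &
      forall (G : set 'rV[R]_n) (h : 'rV[R]_n -> R),
        open G -> bounded_set G ->
        {within closure G, continuous h} -> harmonic_on G h ->
        (forall x, boundary G x -> (u x <= (h x)%:E)%E) ->
        forall x, G x -> (u x <= (h x)%:E)%E].

Definition fine_topology (R : realType) (n : nat) : topologicalType :=
  @sup_topology 'rV[R]_n {u : 'rV[R]_n -> \bar R | subharmonic u}
    (fun u => Topological.class (initial_topology (sval u))).

Definition fine_boundary (R : realType) (n : nat) (K : set 'rV[R]_n) :
    set 'rV[R]_n :=
  @boundary (fine_topology R n) K.

(* Functions on a subset of R^n are represented by total functions, of which
   only the values on that subset matter. *)
Definition dirichlet_solution (R : realType) (n : nat) (U : set 'rV[R]_n)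
    (f h : 'rV[R]_n -> R) : Prop :=
  [/\ {within closure U, continuous h}, harmonic_on U h &
      forall x, boundary U x -> h x = f x].

Definition regular_open (R : realType) (n : nat) (U : set 'rV[R]_n) : Prop :=
  [/\ bounded_set U, open U &
      forall f : 'rV[R]_n -> R, {within boundary U, continuous f} ->
        exists h, dirichlet_solution U f h].

Definition harmonic_measure_open (R : realType) (n : nat) (U : set 'rV[R]_n)
    (z : 'rV[R]_n) (mu : probability (borel_rV R n) R) : Prop :=
  mu (boundary U) = 1%E /\
  forall f h : 'rV[R]_n -> R, {within boundary U, continuous f} ->
    dirichlet_solution U f h ->
    (h z)%:E = (\int[mu]_(x in boundary U) (f x)%:E)%E.

Definition converging_to (R : realType) (n : nat) (K : set 'rV[R]_n)
    (U : nat -> set 'rV[R]_n) : Prop :=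
  [/\ forall j, regular_open (U j),
      forall j, K `<=` U j,
      forall j, closure (U j.+1) `<=` U j &
      forall e : R, 0 < e -> exists j0 : nat, forall j, (j0 <= j)%N ->
        U j `<=` [set x | exists2 y, K y & `|x - y| < e]].

(* All the measures involved live on the compact set closure (U 0), whose
   continuous functions are the restrictions of continuous functions on R^n:
   the last clause is weak* convergence in the dual of C(closure (U 0)). *)
Definition harmonic_measure (R : realType) (n : nat) (K : set 'rV[R]_n)
    (z : 'rV[R]_n) (mu : probability (borel_rV R n) R) : Prop :=
  mu K = 1%E /\
  exists (U : nat -> set 'rV[R]_n) (omega : nat -> probability (borel_rV R n) R),
  [/\ converging_to K U,
      forall j, harmonic_measure_open (U j) z (omega j) &
      forall f : 'rV[R]_n -> R, continuous f ->
        (\int[omega j]_(x in boundary (U j)) (f x)%:E)%E @[j --> \oo]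
          --> (\int[mu]_(x in K) (f x)%:E)%E].

Definition concentrated (R : realType) (n : nat) (K : set 'rV[R]_n)
    (mu : probability (borel_rV R n) R) (E : set 'rV[R]_n) : Prop :=
  forall F : set (borel_rV R n),
    measurable F -> F `<=` K `\` E -> mu F = 0%E.

(* Main.v *)
Require Import Defs.
From mathcomp Require Import measurable_realfun lra.

(**
The proof tests the harmonic measure against the single strictly subharmonic
function [q = dist2 0], the square of the Euclidean norm.

Let [U_j] decrease to [K], let [omega_j] be the harmonic measure of [U_j] at
[z], and let [g_j] be harmonic on [U_j] with boundary values [q]; by the maximum
principle [q <= g_j].  On the one hand the integral of [q] against [omega_j] is
[g_j z], so [g_j z] tends to the integral of [q] against [omega].  On the other
hand [g_j] is harmonic near the closure of [U_k] for all [k > j], so its integral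
against [omega_k] is [g_j z] as well, and in the limit so is its integral against
[omega] ([integral_harmonic]).  Hence the integral of [g_j - q >= 0] against
[omega] tends to 0, and by Markov's inequality [omega] gives no mass to a set on
which all the [g_j - q] stay above a common positive constant.

A subset of [K] that avoids the fine boundary lies in the fine interior, so it
remains to bound [g_j x - q x] from below, uniformly in [j], at each fine interior
point [x] of [K] ([fine_interior_gap]).  The number [g_j x - q x] is the value at
[x] of the solution with boundary values [dist2 x]: if it were small, the harmonic
measure of [U_j] at [x] would be concentrated near [x] in the Euclidean sense.  A
subharmonic [u] then prevents this measure from charging a set [u < u x - d],
because [u x] is at most the mean of [u], while [u] is at most [u x + e] near [x]
by semicontinuity.  Finitely many such sets, and the complement of a ball, cover
the complement of a fine neighbourhood of [x].  As the boundary of [U_j] lies in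
the complement of [K], the harmonic measure would have small total mass, a
contradiction.  The predicate [thin_at] expresses this smallness through harmonic
majorants of indicator functions, which avoids harmonic measures at points other
than [z]; the complements of its open sets generate a filter, and the argument
above says that this filter converges to [x] in the fine topology
([cvg_cothin_fine]).
*)

Set Implicit Arguments.
Unset Strict Implicit.
Unset Printing Implicit Defensive.

Import Order.TTheory GRing.Theory Num.Theory.

Local Open Scope classical_set_scope.
Local Open Scope ring_scope.

(** * The Laplacian *)

Definition laplacian (R : realType) (n : nat) (h : 'rV[R]_n -> R)
    (x : 'rV[R]_n) : R :=
  \sum_(i < n) 'D_(unit_rV R i) ('D_(unit_rV R i) h) x.

Definition C2_on (R : realType) (n : nat) (U : set 'rV[R]_n)
    (h : 'rV[R]_n -> R) : Prop :=
  forall x, U x ->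
  [/\ forall i, derivable h x (unit_rV R i),
      forall i j, derivable ('D_(unit_rV R i) h) x (unit_rV R j) &
      forall i j, {for x, continuous ('D_(unit_rV R j) ('D_(unit_rV R i) h))}].

Definition dist2 (R : realType) (n : nat) (x y : 'rV[R]_n) : R :=
  \sum_(i < n) (y 0 i - x 0 i) ^+ 2.

Section diff.
Variables (R : realType) (n : nat).
Implicit Types (U : set 'rV[R]_n) (f g h : 'rV[R]_n -> R) (x y v : 'rV[R]_n).

Lemma harmonic_onE U h :
  harmonic_on U h <-> C2_on U h /\ forall x, U x -> laplacian h x = 0.
Proof.
split=> [hh|[c2 l0] x Ux]; first by split=> x Ux; have [? ? ? ?] := hh x Ux.
by have [? ? ?] := c2 x Ux; split=> //; exact: l0.
Qed.

Lemma is_derive_lincomb (f g : 'rV[R]_n -> R) (a : R) x v :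
  derivable f x v -> derivable g x v ->
  is_derive x v (fun y => f y + a * g y) ('D_v f x + a * 'D_v g x).
Proof.
move=> /derivableP df /derivableP dg.
exact: (is_deriveD df (is_deriveZ a dg)).
Qed.

(** [f] and [g] being differentiable only on [U], the identities between first
    derivatives hold there only; openness of [U] makes them hold near each point,
    so that they can be differentiated again. *)
Lemma C2_lincomb U f g (a : R) : open U -> C2_on U f -> C2_on U g ->
  C2_on U (fun y => f y + a * g y) /\
  forall x, U x -> laplacian (fun y => f y + a * g y) x
    = laplacian f x + a * laplacian g x.
Proof.
move=> oU cf cg.
have D1 i y : U y -> 'D_(unit_rV R i) (fun y => f y + a * g y) y =
    'D_(unit_rV R i) f y + a * 'D_(unit_rV R i) g y.
  move=> /[dup] /cf[df _ _] /cg[dg _ _].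
  exact: (@derive_val _ _ _ _ _ _ _ (is_derive_lincomb a (df i) (dg i))).
have nU y : U y -> \forall z \near y, U z by move=> Uy; exact: open_nbhs_nbhs.
have D2' i j y : U y -> is_derive y (unit_rV R j)
    ('D_(unit_rV R i) (fun y => f y + a * g y))
    ('D_(unit_rV R j) ('D_(unit_rV R i) f) y
     + a * 'D_(unit_rV R j) ('D_(unit_rV R i) g) y).
  move=> Uy; have [_ df _] := cf y Uy; have [_ dg _] := cg y Uy.
  apply: near_eq_is_derive (is_derive_lincomb a (df i j) (dg i j)).
  by apply: filterS (nU y Uy) => z Uz; rewrite D1.
have D2 i j y : U y -> 'D_(unit_rV R j) ('D_(unit_rV R i)
    (fun y => f y + a * g y)) y =
    'D_(unit_rV R j) ('D_(unit_rV R i) f) y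
     + a * 'D_(unit_rV R j) ('D_(unit_rV R i) g) y.
  by move=> Uy; have H := D2' i j y Uy; rewrite derive_val.
split=> x Ux; last first.
  rewrite /laplacian mulr_sumr -big_split/=.
  by apply: eq_bigr => i _; rewrite D2.
have [df1 _ cf2] := cf x Ux; have [dg1 _ cg2] := cg x Ux.
split=> [i|i j|i j].
- exact: (@ex_derive _ _ _ _ _ _ _ (is_derive_lincomb a (df1 i) (dg1 i))).
- exact: (@ex_derive _ _ _ _ _ _ _ (D2' i j x Ux)).
- suff : 'D_(unit_rV R j) ('D_(unit_rV R i) (fun y => f y + a * g y)) z
      @[z --> x] --> 'D_(unit_rV R j) ('D_(unit_rV R i)
        (fun y => f y + a * g y)) x by [].
  rewrite D2//.
  apply: (@cvg_trans _ ((fun y => 'D_(unit_rV R j) ('D_(unit_rV R i) f) y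
     + a * 'D_(unit_rV R j) ('D_(unit_rV R i) g) y) @ x)).
    apply: (@near_eq_cvg _ _ (nbhs x)); near=> z; rewrite D2//; near: z; exact: nU.
  exact: (cvgD (cf2 i j) (cvgM (cvg_cst a) (cg2 i j))).
Unshelve. all: by end_near. Qed.

Lemma is_derive_coord y v i :
  is_derive y v (fun y : 'rV[R]_n => y 0 i) (v 0 i).
Proof.
apply: DeriveDef.
  apply/cvg_ex; exists (v 0 i).
  apply: cvg_near_cst; near=> t.
  rewrite /= !mxE addrK /GRing.scale/= mulrA mulVf ?mul1r//.
  by near: t; exact: nbhs_dnbhs_neq.
apply: cvg_lim => //; apply: cvg_near_cst; near=> t.
rewrite /= !mxE addrK /GRing.scale/= mulrA mulVf ?mul1r//.
by near: t; exact: nbhs_dnbhs_neq.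
Unshelve. all: by end_near. Qed.

Lemma is_derive_coordB x y v i :
  is_derive y v (fun y : 'rV[R]_n => y 0 i - x 0 i) (v 0 i).
Proof.
have := is_deriveB (is_derive_coord y v i) (is_derive_cst (x 0 i) y v).
by rewrite subr0.
Qed.

Lemma is_derive_dist2 x y v : is_derive y v (dist2 x)
  (\sum_(i < n) 2 * v 0 i * (y 0 i - x 0 i)).
Proof.
rewrite /dist2.
have -> : (fun y => \sum_(i < n) (y 0 i - x 0 i) ^+ 2) =
  \sum_(i < n) (fun y : 'rV[R]_n => (y 0 i - x 0 i) ^+ 2).
  by apply/funext => z; rewrite fct_sumE.
apply: is_derive_sum => i.
apply: (is_derive_eq (@is_deriveX _ _ _ 2 _ _ _ (is_derive_coordB x y v i))).
by rewrite /GRing.scale/= expr1 mulrAC mulr_natl.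
Qed.

Lemma dist2_C2 U x : C2_on U (dist2 x) /\
  forall y, laplacian (dist2 x) y = (2 * n)%:R.
Proof.
have D1 v : 'D_v (dist2 x) =
    fun y => \sum_(i < n) 2 * v 0 i * (y 0 i - x 0 i).
  by apply/funext => y; have H := is_derive_dist2 x y v; rewrite derive_val.
have D2' v w y : is_derive y w ('D_v (dist2 x))
    (\sum_(i < n) 2 * v 0 i * w 0 i).
  rewrite D1.
  have -> : (fun y => \sum_(i < n) 2 * v 0 i * (y 0 i - x 0 i)) =
    \sum_(i < n) (2 * v 0 i *: (fun y : 'rV[R]_n => y 0 i - x 0 i)).
    by apply/funext => z; rewrite fct_sumE.
  apply: is_derive_sum => i.
  exact: (is_deriveZ (2 * v 0 i) (is_derive_coordB x y w i)).
have D2 v w y : 'D_w ('D_v (dist2 x)) y = \sum_(i < n) 2 * v 0 i * w 0 i.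
  by have H := D2' v w y; rewrite derive_val.
split=> [y _|y].
  split=> [i|i j|i j].
  - exact: (@ex_derive _ _ _ _ _ _ _ (is_derive_dist2 x y _)).
  - exact: (@ex_derive _ _ _ _ _ _ _ (D2' _ _ y)).
  - have -> : 'D_(unit_rV R j) ('D_(unit_rV R i) (dist2 x)) =
        cst (\sum_(k < n) 2 * unit_rV R i 0 k * unit_rV R j 0 k).
      by apply/funext => z; rewrite D2.
    exact: (@cst_continuous _ _ _ y).
have -> : (2 * n)%:R = \sum_(i < n) (2 : R).
  by rewrite sumr_const card_ord natrM mulr_natr.
rewrite /laplacian; apply: eq_bigr => i _.
rewrite D2 (bigD1 i)//= big1; last first.
  by move=> j ji; rewrite /unit_rV mxE (negbTE ji) andbF mulr0.
by rewrite addr0 /unit_rV mxE !eqxx !mulr1.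
Qed.

End diff.

(** * The maximum principle *)

Section maxp.
Variables (R : realType) (n : nat).
Implicit Types (U : set 'rV[R]_n) (f g h : 'rV[R]_n -> R) (x y v : 'rV[R]_n).

Lemma is_derive_line f x v (t : R) : derivable f (x + t *: v) v ->
  is_derive t 1 (fun s => f (x + s *: v)) ('D_v f (x + t *: v)).
Proof.
move=> df.
have E : (fun h : R => h^-1 *: (((fun s => f (x + s *: v)) \o shift t) (h *: 1)
      - f (x + t *: v))) =
   (fun h : R => h^-1 *: ((f \o shift (x + t *: v)) (h *: v) - f (x + t *: v))).
  apply/funext => h /=; congr (_ *: (f _ - _)).
  have -> : h *: (1 : R) = h by exact: mulr1.
  by rewrite scalerDl addrCA.
apply: DeriveDef.
  by rewrite /derivable E.
by rewrite /derive E.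
Qed.

Lemma line_in_open U x v : open U -> U x ->
  exists2 r : R, 0 < r & forall t, `|t| < r -> U (x + t *: v).
Proof.
move=> oU Ux.
have : (fun t : R => x + t *: v) @ 0 --> x + 0 *: v.
  by apply: cvgD; [exact: cvg_cst|apply: cvgZr_tmp; exact: cvg_id].
move=> /(_ U); rewrite scale0r addr0 => /(_ (open_nbhs_nbhs (conj oU Ux))).
move=> /nbhs_ballP[r r0 rU]; exists r => // t tr; apply: rU.
by rewrite /ball/= sub0r normrN.
Qed.

(** Restrict [f] to the line through the maximum. If the second derivative were
    positive there, the first one, which vanishes at the maximum, would be positive
    just after it, and [f] would increase by the mean value theorem. *)
Lemma second_derivative_at_max U f x i : open U -> C2_on U f -> U x ->
  (forall y, U y -> f y <= f x) ->
  'D_(unit_rV R i) ('D_(unit_rV R i) f) x <= 0.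
Proof.
set e := unit_rV R i => oU cf Ux fmax; rewrite leNgt; apply/negP => d0.
have [r r0 rU] := line_in_open e oU Ux.
set phi := fun t : R => f (x + t *: e).
have dphi (t : R) : `|t| < r -> is_derive t 1 phi ('D_e f (x + t *: e)).
  by move=> /rU/cf[df _ _]; exact: is_derive_line (df i).
have rI t : (t \in `](- r), r[%R) -> `|t| < r.
  by rewrite in_itv/= ltr_norml.
(* Fermat's rule on the line *)
have G0 : 'D_e f x = 0.
  have H : is_derive (0 : R) 1 phi 0.
    apply: (@derive1_at_max _ _ (- r) r) => //.
    - by rewrite (@le_trans _ _ 0)// ?oppr_le0 ltW.
    - by move=> t /rI/dphi/(@ex_derive _ _ _ _ _ _ _).
    - by rewrite in_itv/= oppr_lt0 r0.
    - by move=> t /rI tr; rewrite /phi scale0r addr0; exact/fmax/rU.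
  have r00 : `|0 : R| < r by rewrite normr0.
  have H2 := dphi 0 r00.
  by rewrite -(@derive_val _ _ _ _ _ _ _ H) (@derive_val _ _ _ _ _ _ _ H2)
    scale0r addr0.
have [_ /(_ i i) d2 _] := cf x Ux.
have : \forall t \near 0^', 0 < t^-1 *: ('D_e f (t *: e + x) - 'D_e f x).
  exact: (cvgr_gt _ d2 _ d0).
move=> /nbhs_ballP[s s0 sP].
pose m := Num.min r s / 2.
have m0 : 0 < m by rewrite divr_gt0// lt_min r0.
have mrs : (m < r) && (m < s).
  by rewrite -lt_min /m ltr_pdivrMr// ltr_pMr ?lt_min ?r0// ltr1n.
case/andP: mrs => mr ms.
have tm t : 0 <= t <= m -> `|t| < r.
  by move=> /andP[t0 tm]; rewrite ger0_norm// (le_lt_trans tm).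
(* [m] is so small that the segment stays in [U] and [d2] gives the sign. *)
have [] := @MVT _ phi (fun t => 'D_e f (x + t *: e)) 0 m m0.
- by move=> t; rewrite in_itv/= => /andP[/ltW t0 /ltW tm']; apply: dphi;
    apply: tm; rewrite t0.
- apply: derivable_within_continuous => t; rewrite in_itv/= => /tm/dphi.
  exact: (@ex_derive _ _ _ _ _ _ _).
move=> c; rewrite in_itv/= => /andP[c0 cm].
have : 0 < c^-1 *: ('D_e f (c *: e + x) - 'D_e f x).
  apply: sP; last by rewrite gt_eqF.
  by rewrite /ball/= sub0r normrN gtr0_norm// (lt_trans cm).
rewrite G0 subr0 pmulr_rgt0 ?invr_gt0// addrC => Gc E.
have : phi m <= phi 0.
  by rewrite /phi scale0r addr0; apply/fmax/rU/tm; rewrite lexx ltW.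
by rewrite leNgt -subr_gt0 E subr0 mulr_gt0.
Qed.

Lemma bounded_closure_compact U : bounded_set U -> compact (closure U).
Proof.
move=> [M [Mr MU]]; apply: bounded_closed_compact; last exact: closed_closure.
exists (M + 1); split; first by rewrite num_real.
move=> b Mb x /(_ (ball x 1) (nbhsx_ballx _ _ ltr01))[y [Uy]].
rewrite -ball_normE/= => xy.
have := MU (b - 1); rewrite ltrBrDr => /(_ Mb y Uy)/=.
rewrite lerBrDr; apply: le_trans.
by rewrite addrC -lerBlDr (le_trans (lerB_dist _ _))// ltW.
Qed.

Lemma boundaryP U x : open U -> boundary U x <-> closure U x /\ ~ U x.
Proof.
move=> oU; split=> -[cx nx]; split=> //.
  by move=> Ux; apply: nx; move: oU; rewrite openE; exact.
by move=> /interior_subset.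
Qed.

(** At an interior maximum every pure second derivative is nonpositive, hence so is
    the Laplacian. *)
Lemma max_principle_strict U f (M : R) :
  bounded_set U -> open U -> C2_on U f ->
  (forall x, U x -> 0 < laplacian f x) -> {within closure U, continuous f} ->
  (forall x, boundary U x -> f x <= M) -> forall x, U x -> f x <= M.
Proof.
move=> bU oU cf lf ctf bf x Ux.
have [|p] := EVT_max_rV _ (bounded_closure_compact bU) ctf.
  by exists x; exact: subset_closure.
rewrite inE => cp pmax.
have cx : x \in closure U by rewrite inE; exact: subset_closure.
have [Up|nUp] := pselect (U p).
  exfalso; have := lf p Up; rewrite ltNge => /negP; apply.
  apply: sumr_le0 => i _; apply: second_derivative_at_max oU cf Up _ => y Uy.
  by apply: pmax; rewrite inE; exact: subset_closure.
by rewrite (le_trans (pmax x cx))//; apply: bf; exact/boundaryP.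
Qed.

Lemma dist2_continuous x : continuous (dist2 x).
Proof.
have -> : dist2 x = \sum_(i < n) (fun y : 'rV[R]_n => (y 0 i - x 0 i) ^+ 2).
  by apply/funext => z; rewrite fct_sumE.
apply: (big_ind (fun f : 'rV[R]_n -> R => continuous f)).
- exact: cst_continuous.
- by move=> f g cf cg y; exact: continuousD (cf y) (cg y).
- move=> i _ y.
  have c : (fun z : 'rV[R]_n => z 0 i - x 0 i) @ y --> y 0 i - x 0 i.
    exact: (cvgB (@coord_continuous R 1 n 0 i y) (cvg_cst (x 0 i))).
  exact: (cvgM c c).
Qed.

Lemma dist2_ge0 x y : 0 <= dist2 x y.
Proof. by apply: sumr_ge0 => i _; exact: sqr_ge0. Qed.

Lemma dist2xx x : dist2 x x = 0.
Proof. by rewrite /dist2 big1// => i _; rewrite subrr expr0n. Qed.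

Lemma ball_dist2 x y (r : R) : 0 < r -> dist2 x y < r ^+ 2 -> ball x r y.
Proof.
move=> r0 dr; rewrite -ball_normE/= -normrN opprB [`|_|]mx_normrE.
apply: bigmax_lt => // -[i j] _ /=; rewrite (ord1 i) !mxE.
rewrite -(@ltr_pXn2r _ 2) ?nnegrE ?normr_ge0 ?(ltW r0)//.
apply: le_lt_trans dr; rewrite real_normK ?num_real//.
rewrite /dist2 (bigD1 j)//= lerDl.
by apply: sumr_ge0 => k _; exact: sqr_ge0.
Qed.

Lemma within_lincomb U f g (a : R) :
  {within closure U, continuous f} -> {within closure U, continuous g} ->
  {within closure U, continuous (fun y => f y + a * g y)}.
Proof.
move=> cf cg y.
exact: (cvgD (cf y) (cvgM (cvg_cst a) (cg y))).
Qed.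

(** Adding a small multiple of the strictly subharmonic function [dist2 x] reduces
    the claim to the strict case; the perturbation vanishes at [x]. *)
Lemma max_principle U f (M : R) : (0 < n)%N ->
  bounded_set U -> open U -> C2_on U f ->
  (forall x, U x -> 0 <= laplacian f x) -> {within closure U, continuous f} ->
  (forall x, boundary U x -> f x <= M) -> forall x, U x -> f x <= M.
Proof.
move=> n0 bU oU cf lf ctf bf x Ux.
have cd A : {within A, continuous (dist2 x)}.
  exact: continuous_subspaceT (@dist2_continuous x).
have [|p] := EVT_max_rV _ (bounded_closure_compact bU) (cd _).
  by exists x; exact: subset_closure.
rewrite inE => _ pmax.
have [c2 lc2] := dist2_C2 U x.
apply/ler_addgt0Pr => e e0.
pose d := e / (dist2 x p + 1).
have D0 : 0 < dist2 x p + 1 by rewrite ltr_wpDl ?dist2_ge0.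
have d0 : 0 < d by rewrite divr_gt0.
have [c l] := C2_lincomb d oU cf c2.
have := @max_principle_strict U (fun y => f y + d * dist2 x y) (M + e) bU oU c.
rewrite -[X in _ -> X <= _]addr0.
have -> : f x + 0 = f x + d * dist2 x x by rewrite dist2xx mulr0.
apply=> //.
- move=> y Uy; rewrite l// lc2 ltr_wpDl ?lf// mulr_gt0// ltr0n.
  by rewrite muln_gt0.
- exact: within_lincomb.
- move=> y [By nUy]; apply: lerD; first exact: bf.
  rewrite /d mulrAC ler_pdivrMr// ler_pM2l//.
  by rewrite (le_trans (pmax y _)) ?inE// lerDl.
Qed.

Lemma harmonic_on_cst U (c : R) : harmonic_on U (fun=> c).
Proof.
have D1 v y : 'D_v (fun=> c) y = 0 by rewrite derive_cst.
have D1f v : 'D_v (fun=> c) = (fun=> 0 : R) by apply/funext => y; rewrite D1.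
have D2 v w y : 'D_w ('D_v (fun=> c)) y = 0.
  by rewrite D1f derive_cst.
have D2f v w : 'D_w ('D_v (fun=> c)) = (fun=> 0 : R).
  by apply/funext => y; rewrite D2.
move=> x _; split=> [i|i j|i j|].
- exact: derivable_cst.
- by rewrite D1f; exact: derivable_cst.
- by rewrite D2f; exact: (@cst_continuous _ _ _ x).
- by rewrite big1// => i _; rewrite D2.
Qed.

Lemma harmonic_lincomb U f g (a : R) : open U ->
  harmonic_on U f -> harmonic_on U g -> harmonic_on U (fun y => f y + a * g y).
Proof.
move=> oU /harmonic_onE[cf lf] /harmonic_onE[cg lg].
have [c l] := C2_lincomb a oU cf cg.
by apply/harmonic_onE; split=> // x Ux; rewrite l// lf// lg// mulr0 addr0.
Qed.

Lemma harmonic_ge U f (m : R) : (0 < n)%N ->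
  bounded_set U -> open U -> harmonic_on U f ->
  {within closure U, continuous f} ->
  (forall x, boundary U x -> m <= f x) -> forall x, U x -> m <= f x.
Proof.
move=> n0 bU oU hf ctf bf x Ux.
have /harmonic_onE[c l] := harmonic_lincomb (-1) oU (@harmonic_on_cst U 0) hf.
rewrite -lerN2 -mulN1r -[leLHS]add0r.
apply: (@max_principle U (fun y => 0 + -1 * f y) (- m) n0 bU oU c) Ux.
- by move=> y Uy; rewrite l.
- by apply: within_lincomb ctf; exact/continuous_subspaceT/cst_continuous.
- by move=> y Uy; rewrite add0r mulN1r lerN2 bf.
Qed.

(** [dist2 y] and [dist2 x] differ by an affine function, which is harmonic. This
    converts the solution for [dist2 0] into the one centered at any point. *)
Lemma dirichlet_dist2_shift U x y g : open U ->
  dirichlet_solution U (dist2 x) g ->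
  dirichlet_solution U (dist2 y)
    (fun z => g z + 1 * (dist2 y z + -1 * dist2 x z)).
Proof.
move=> oU [ctg hg bg].
have cd z : {within closure U, continuous (dist2 z)}.
  exact: continuous_subspaceT (@dist2_continuous z).
have [cx lx] := dist2_C2 U x.
have [cy ly] := dist2_C2 U y.
have [c l] := C2_lincomb (-1) oU cy cx.
split.
- by apply: within_lincomb => //; exact: within_lincomb.
- apply: harmonic_lincomb => //; apply/harmonic_onE; split=> // z Uz.
  by rewrite l// lx ly mulN1r subrr.
- by move=> z Uz; rewrite bg// mul1r mulN1r addrCA subrr addr0.
Qed.

(** By recentering at [y], the difference of the two sides is the value at [y] of a
    harmonic function with nonnegative boundary values. *)
Lemma dirichlet_dist2_ge U x g : (0 < n)%N -> bounded_set U -> open U ->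
  dirichlet_solution U (dist2 x) g -> forall y, U y -> dist2 x y <= g y.
Proof.
move=> n0 bU oU sg y Uy.
have [ctg hg bg] := dirichlet_dist2_shift y oU sg.
have := @harmonic_ge U _ 0 n0 bU oU hg ctg.
move=> /(_ _ y Uy); rewrite dist2xx add0r mul1r mulN1r subr_ge0; apply.
by move=> z bz; rewrite bg// dist2_ge0.
Qed.

End maxp.

(** * Thin sets *)

(** [h] majorizes on the boundary of [U] the indicator function of the part of [F]
    in it, so [h x] bounds the harmonic measure of that part seen from [x]. The
    harmonic measure of [W] is thus required to be small as soon as [g x], the mean
    square distance to [x] of the boundary of [U], is small, uniformly in [U]. The
    closed set [F] leaves room, between [F] and the complement of [W], for a
    continuous boundary function. *)
Definition thin_at (R : realType) (n : nat) (D : set 'rV[R]_n) (x : 'rV[R]_n)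
    (W : set 'rV[R]_n) : Prop :=
  forall e : R, 0 < e -> exists C : R,
  forall (U : set 'rV[R]_n) (g : 'rV[R]_n -> R),
    regular_open U -> U `<=` D -> U x -> dirichlet_solution U (dist2 x) g ->
  forall F : set 'rV[R]_n, closed F -> F `<=` W ->
  exists h : 'rV[R]_n -> R,
    [/\ harmonic_on U h, {within closure U, continuous h},
        forall y, boundary U y -> 0 <= h y,
        forall y, boundary U y -> F y -> 1 <= h y &
        h x <= e + C * g x].

Section thin.
Variables (R : realType) (n : nat).
Implicit Types (D U W F : set 'rV[R]_n) (x y : 'rV[R]_n)
  (u : 'rV[R]_n -> \bar R).

(** A Urysohn function separating the part of [F] outside [W1] from the part outside
    [W2] cuts [F] in two. *)
Lemma closed_split F W1 W2 : closed F -> open W1 -> open W2 ->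
  F `<=` W1 `|` W2 -> exists F1 F2, [/\ closed F1, closed F2, F1 `<=` W1,
    F2 `<=` W2 & F `<=` F1 `|` F2].
Proof.
move=> cF oW1 oW2 FW.
have c1 : closed (F `&` ~` W1) by apply: closedI => //; exact: open_closedC.
have c2 : closed (F `&` ~` W2) by apply: closedI => //; exact: open_closedC.
have [|f [cf f0 f1 _]] :=
    urysohn_ext_itv (@pseudometric_normal R 'rV[R]_n) c1 c2 _ (@ltr01 R).
  by rewrite -subset0 => y [[Fy nW1] [_ nW2]]; case: (FW y Fy).
exists (F `&` f @^-1` [set t | 2^-1 <= t]), (F `&` f @^-1` [set t | t <= 2^-1]).
split.
- by apply: closedI => //; apply: closed_comp => // *; exact: closed_ge.
- by apply: closedI => //; apply: closed_comp => // *; exact: closed_le.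
- move=> y [Fy /= fy]; apply: contrapT => nW.
  have fy0 : f y = 0 by apply: f0; exists y.
  by move: fy; rewrite fy0 leNgt invr_gt0 ltr0n.
- move=> y [Fy /= fy]; apply: contrapT => nW.
  have fy1 : f y = 1 by apply: f1; exists y.
  by move: fy; rewrite fy1 leNgt invf_lt1 ?ltr1n.
- move=> y Fy; have [h|/ltW h] := leP 2^-1 (f y); [left|right]; by split.
Qed.

Lemma thin_atU D x W1 W2 : open W1 -> open W2 -> thin_at D x W1 ->
  thin_at D x W2 -> thin_at D x (W1 `|` W2).
Proof.
move=> o1 o2 s1 s2 e e0.
have e20 : 0 < e / 2 by rewrite divr_gt0.
have [C1 h1] := s1 _ e20; have [C2 h2] := s2 _ e20.
exists (C1 + C2) => U g rU UD Ux sg F cF FW.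
have [F1 [F2 [cF1 cF2 FW1 FW2 FF]]] := closed_split cF o1 o2 FW.
have [f1 [hf1 cf1 f10 f11 f1x]] := h1 U g rU UD Ux sg F1 cF1 FW1.
have [f2 [hf2 cf2 f20 f21 f2x]] := h2 U g rU UD Ux sg F2 cF2 FW2.
have [_ oU _] := rU.
exists (fun y => f1 y + 1 * f2 y); split.
- exact: harmonic_lincomb.
- exact: within_lincomb.
- by move=> y By; rewrite mul1r addr_ge0 ?f10 ?f20.
- move=> y By /FF[] Fy; rewrite mul1r.
    by rewrite -[1]addr0 lerD ?f11 ?f20.
  by rewrite -[1]add0r lerD ?f10 ?f21.
- rewrite mul1r (le_trans (lerD f1x f2x))//.
  by rewrite addrACA -splitr mulrDl.
Qed.

Lemma open_far x (r : R) : open [set y | r < dist2 x y].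
Proof.
apply: (@open_comp _ _ (dist2 x) [set t | r < t]); last exact: open_gt.
by move=> y _; exact: dist2_continuous.
Qed.

(** Chebyshev's inequality: the indicator function is at most [dist2 x] over [r]. *)
Lemma thin_at_far D x (r : R) : 0 < r -> thin_at D x [set y | r < dist2 x y].
Proof.
move=> r0 e e0; exists r^-1 => U g rU UD Ux [cg hg bg] F cF FW.
have [_ oU _] := rU.
exists (fun y => 0 + r^-1 * g y); split.
- apply: harmonic_lincomb => //; exact: harmonic_on_cst.
- by apply: within_lincomb => //; exact/continuous_subspaceT/cst_continuous.
- by move=> y By; rewrite add0r mulr_ge0 ?bg ?dist2_ge0 ?invr_ge0 ?ltW.
- move=> y By /FW/= rd; rewrite add0r bg// mulrC.
  by rewrite ler_pdivlMr// mul1r ltW.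
- by rewrite lerD2r ltW.
Qed.

Lemma open_sublevel u (a : R) : lower_semicontinuous (fun x => - u x)%E ->
  open [set y | u y < a%:E]%E.
Proof.
move=> /lower_semicontinuousP /(_ (- a)).
congr (open _); apply/seteqP; split=> y /=; by rewrite EFinN lteN2.
Qed.

(** The open sets where [u < m], for natural numbers [m], cover the compact
    closure of [D]. *)
Lemma usc_bounded_above D u : bounded_set D ->
  lower_semicontinuous (fun x => - u x)%E -> (forall x, u x < +oo)%E ->
  exists M : R, forall y, closure D y -> (u y <= M%:E)%E.
Proof.
move=> bD usc uoo.
have := bounded_closure_compact bD; rewrite compact_cover.
move=> /(_ nat setT (fun m => [set y | u y < m%:R%:E]%E)).
case=> [m _|y _|s _ sD].
- exact: open_sublevel.
- have [k uk] : exists k : nat, (u y < k%:R%:E)%E.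
    have := uoo y; case: (u y) => // [a _|_]; last by exists 0%N; rewrite ltNyr.
    exists (Num.truncn `|a|).+1.
    by rewrite lte_fin (le_lt_trans (ler_norm a))// truncnS_gt.
  by exists k.
- exists (\sum_(m <- finmap.enum_fset s) m%:R) => y /sD[m /= ms um].
  apply: (le_trans (ltW um)); rewrite lee_fin (big_rem m)//= lerDl.
  by apply: sumr_ge0 => i _; exact: ler0n.
Qed.

(** Let [f] be a continuous function with values in the unit interval, equal to 1 on
    [F] and to 0 off the sublevel set. On the boundary of [U],
    [u <= c + e * d - d * f + A * dist2 x]
    where the last term, with [A] large, takes care of the points far from [x], at
    which [u <= c + e * d] may fail. The harmonic function with these boundary
    values is at least [u x = c] at [x], which bounds the solution for [f] at [x]. *)
Lemma thin_at_sublevel D x u (c d : R) : bounded_set D -> subharmonic u ->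
  u x = c%:E -> 0 < d -> thin_at D x [set y | u y < (c - d)%:E]%E.
Proof.
move=> bD [uoo usc us] ux d0 e e0.
have [M uM] := usc_bounded_above bD usc uoo.
have ed0 : 0 < e * d by rewrite mulr_gt0.
have : nbhs x [set y | u y < (c + e * d)%:E]%E.
  apply: open_nbhs_nbhs; split; first exact: open_sublevel.
  by rewrite /= ux lte_fin ltrDl.
move=> /nbhs_ballP[r r0 rB].
(* so that [A * dist2 x] exceeds [M - c] at all points far from [x] *)
pose A := (`|M - c| + 1) / r ^+ 2.
have A0 : 0 < A by rewrite divr_gt0 ?exprn_gt0// ltr_wpDl.
exists (A / d) => U g rU UD Ux sg F cF FW.
have [bU oU] := rU.
have oW : open [set y | u y < (c - d)%:E]%E by exact: open_sublevel.
have [|f [cf f0 f1 f01]] :=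
    urysohn_ext_itv (@pseudometric_normal R 'rV[R]_n) (open_closedC oW) cF _
      (@ltr01 R).
  by rewrite -subset0 => y [nW Fy]; apply: nW; exact: FW.
move=> /(_ f)[]; first exact: continuous_subspaceT.
move=> h [ch hh bh].
have fI y : 0 <= f y <= 1.
  by have := f01 (f y) (ex_intro2 _ _ y I erefl); rewrite /= in_itv.
exists h; split=> //.
- by move=> y By; rewrite bh//; case/andP: (fI y).
- move=> y By Fy; rewrite bh//; have -> : f y = 1 by apply: f1; exists y.
  exact: lexx.
have [cg hg bg] := sg.
pose w := fun y => (fun y => (c + e * d) + (- d) * h y) y + A * g y.
have hw : harmonic_on U w.
  do 2! apply: harmonic_lincomb => //; exact: harmonic_on_cst.
have cw : {within closure U, continuous w}.
  do 2! apply: within_lincomb => //; exact/continuous_subspaceT/cst_continuous.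
have : (u x <= (w x)%:E)%E.
  apply: (us U w) => // y By; rewrite /w bh// bg//.
  (* in the sublevel set the drop [- d] pays for [f <= 1]; off it [f] vanishes *)
  have [uy|uy] := ltP (u y) (c - d)%:E.
    apply: (le_trans (ltW uy)); rewrite lee_fin.
    have /andP[f0' f1'] := fI y.
    have : d * f y <= d by rewrite ler_piMr// ltW.
    have : 0 <= A * dist2 x y by rewrite mulr_ge0 ?dist2_ge0 ?ltW.
    by move: ed0; rewrite mulNr; lra.
  have -> : f y = 0 by apply: f0; exists y => //; apply/negP; rewrite -leNgt.
  rewrite mulr0 addr0.
  have [dr|dr] := ltP (dist2 x y) (r ^+ 2).
    apply: (le_trans (ltW (rB y (ball_dist2 r0 dr)))).
    by rewrite lee_fin lerDl mulr_ge0 ?dist2_ge0 ?ltW.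
  have cDy : closure D y by apply: closureS UD _ _; case: By.
  apply: (le_trans (uM y cDy)); rewrite lee_fin.
  have : `|M - c| + 1 <= A * dist2 x y.
    by rewrite /A mulrAC ler_pdivlMr ?exprn_gt0// ler_pM2l// ltr_wpDl.
  have := ler_norm (M - c).
  by move: ed0; lra.
rewrite ux lee_fin /w => H.
have -> : A / d * g x = A * g x / d by rewrite mulrAC.
rewrite -lerBlDl ler_pdivlMr// mulrBl mulrC.
by move: H; rewrite mulNr; lra.
Qed.

End thin.

(** * The fine topology *)

Section fine.
Variables (R : realType) (n : nat).
Implicit Types (D U W K : set 'rV[R]_n) (x y : 'rV[R]_n)
  (u : 'rV[R]_n -> \bar R).

(** The union of two thin sets being thin, the sets whose complement is contained in
    an open thin set form a filter. *)
Definition cothin D x : set_system 'rV[R]_n :=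
  [set S | exists W, [/\ open W, thin_at D x W & ~` S `<=` W]].

Lemma cothin_filter D x : Filter (cothin D x).
Proof.
split.
- exists [set y | 1 < dist2 x y]; split.
  + exact: open_far.
  + exact: thin_at_far.
  + by rewrite setCT; exact: sub0set.
- move=> S T [V [oV sV SV]] [W [oW sW TW]]; exists (V `|` W); split.
  + exact: openU.
  + exact: thin_atU.
  + by rewrite setCI; exact: setUSS.
- move=> S T ST [W [oW sW SW]]; exists W; split=> //.
  by apply: subset_trans SW; exact: subsetC.
Qed.

Lemma cothin_nbhs D x N : nbhs x N -> cothin D x N.
Proof.
move=> /nbhs_ballP[r /= r0 rN]; exists [set y | (r / 2) ^+ 2 < dist2 x y].
split; first exact: open_far.
- by apply: thin_at_far; rewrite exprn_gt0// divr_gt0.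
- move=> y nN /=; rewrite ltNge; apply/negP => dr; apply: nN; apply: rN.
  apply: (ball_dist2 r0); apply: (le_lt_trans dr).
  by rewrite ltr_pXn2r ?nnegrE ?divr_ge0 ?ltW// ltr_pdivrMr// ltr_pMr// ltr1n.
Qed.

(** Neighbourhoods of [u x] bound [u] from above, an open condition, and from below,
    a condition that fails on a thin set only. *)
Lemma cvg_cothin_subharmonic D x u : bounded_set D -> subharmonic u ->
  u y @[y --> cothin D x] --> u x.
Proof.
move=> bD su; have [uoo usc _] := su; have FF := cothin_filter D x.
move=> O /=.
have near_lt (b : R) : (u x < b%:E)%E -> cothin D x [set y | u y < b%:E]%E.
  move=> ub; apply/cothin_nbhs/open_nbhs_nbhs; split=> //.
  exact: open_sublevel.
case E : (u x) => [c||].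
- move=> cO.
  have /nbhs_ballP[e /= e0 eO] : nbhs c (fun t => O t%:E) by [].
  have H1 : cothin D x [set y | u y < (c + e)%:E]%E.
    by apply: near_lt; rewrite E lte_fin ltrDl.
  have H2 : cothin D x [set y | (c - e / 2)%:E <= u y]%E.
    exists [set y | u y < (c - e / 2)%:E]%E; split.
    + exact: open_sublevel.
    + by apply: thin_at_sublevel => //; rewrite divr_gt0.
    + by move=> y /= /negP; rewrite -ltNge.
  apply: filterS (filterI H1 H2) => y /= [].
  case: (u y) => //= t; rewrite !lte_fin lee_fin => te et; apply: eO.
  by rewrite -ball_normE/= ltr_norml; apply/andP; split; lra.
- by move: (uoo x); rewrite E.
- move=> [M [Mr MO]].
  have H : cothin D x [set y | u y < M%:E]%E by apply: near_lt; rewrite E ltNyr.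
  by apply: filterS H => y; exact: MO.
Qed.

(** A filter converges in the fine topology as soon as all subharmonic functions
    converge along it, so fine neighbourhoods of [x] have thin complements. *)
Lemma cvg_cothin_fine D x : bounded_set D ->
  cothin D x --> (x : fine_topology R n).
Proof.
move=> bD; have FF := cothin_filter D x.
apply/cvg_sup => -[u su] /= A.
rewrite (@nbhsE (initial_topology u)) => -[B [[V oV <-] Vx] BA].
have FV : cothin D x (u @^-1` V).
  by apply: (cvg_cothin_subharmonic bD su); exact: open_nbhs_nbhs.
exact: filterS FV.
Qed.

(** The boundary of [U] avoids [K], hence lies in a thin set. A harmonic function that
    is at least 1 on all of the boundary is at least 1 at [x], so [g x] cannot be
    small. *)
Lemma fine_interior_gap D K x : (0 < n)%N -> bounded_set D ->
  @interior (fine_topology R n) K x ->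
  exists2 c : R, 0 < c & forall U g, regular_open U -> U `<=` D -> K `<=` U ->
    dirichlet_solution U (dist2 x) g -> c <= g x.
Proof.
move=> n0 bD iK; have [W [oW sW KW]] := cvg_cothin_fine bD iK.
have e0 : 0 < 2^-1 :> R by rewrite invr_gt0.
have [C hC] := sW _ e0.
exists (2^-1 / (`|C| + 1)); first by rewrite divr_gt0// ltr_wpDl.
move=> U g rU UD KU sg; have [bU oU _] := rU.
have Ux : U x := KU _ (@interior_subset (fine_topology R n) _ _ iK).
have [|h [hh ch _ h1 hx]] := hC U g rU UD Ux sg (~` U) (open_closedC oU).
  by apply: subset_trans KW; exact: subsetC.
have : 1 <= h x.
  apply: harmonic_ge hh ch _ _ Ux => // y By; apply: h1 => //.
  by have [] := (boundaryP y oU).1 By.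
have g0 : 0 <= g x by rewrite -(dist2xx x); exact: dirichlet_dist2_ge sg _ Ux.
have : C * g x <= (`|C| + 1) * g x.
  by rewrite ler_wpM2r// (le_trans (ler_norm _))// lerDl.
rewrite ler_pdivrMr ?ltr_wpDl// [g x * _]mulrC; lra.
Qed.

End fine.

(** * Integration of continuous functions *)

Section borel.
Variables (R : realType) (n : nat).
Implicit Types (A K U : set 'rV[R]_n) (f : 'rV[R]_n -> R).

Lemma open_borel A : open A -> measurable (A : set (borel_rV R n)).
Proof. by move=> oA; exact: sub_sigma_algebra. Qed.

Lemma closed_borel A : closed A -> measurable (A : set (borel_rV R n)).
Proof.
move=> cA; have := measurableC (open_borel (closed_openC cA)).
by rewrite setCK.
Qed.

Lemma continuous_borel f : continuous f ->
  measurable_fun setT (f : borel_rV R n -> R).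
Proof.
move=> /continuousP cf.
apply: (measurability _ (RGenOpens.measurableE R)).
move=> _ [_ [a [b ->] <-]]; rewrite setTI.
by apply: open_borel; apply: cf; exact: interval_open.
Qed.

Lemma compact_integrable (mu : probability (borel_rV R n) R) K f :
  compact K -> continuous f ->
  mu.-integrable (K : set (borel_rV R n)) (EFin \o f).
Proof.
move=> cK cf.
have mK : measurable (K : set (borel_rV R n)).
  by apply: closed_borel; exact: compact_closed.
apply: measurable_bounded_integrable => //.
- by rewrite (le_lt_trans (probability_le1 mu mK))// ltry.
- exact: measurable_funTS (continuous_borel cf).
- have /compact_bounded[M [_ mrt]] :=
    continuous_compact (continuous_subspaceT cf) cK.
  exists M; split; first by rewrite num_real.
  by move=> ? ? ? ?; exact: mrt.
Qed.

Lemma within_extension A f : closed A -> bounded_set A ->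
  {within A, continuous f} ->
  exists2 k : 'rV[R]_n -> R, continuous k & forall y, A y -> k y = f y.
Proof.
move=> cA bA cf; have cptA := bounded_closed_compact bA cA.
have /compact_bounded[M [_ mrt]] := continuous_compact cf cptA.
have [|y Ay|k [kf ck _]] := @continuous_bounded_extension _ R
    (@pseudometric_normal R 'rV[R]_n) A cA f (`|M| + 1) _ cf.
- by rewrite ltr_wpDl.
- by apply: mrt; [rewrite ltr_pwDr// ler_norm|exists y].
by exists k => // y Ay; rewrite kf// inE.
Qed.

Lemma markov_compact (mu : probability (borel_rV R n) R) K A f (c d : R) :
  compact K -> continuous f -> measurable (A : set (borel_rV R n)) -> A `<=` K ->
  (forall x, K x -> 0 <= f x) -> (forall x, A x -> c <= f x) -> 0 < c ->
  (\int[mu]_(x in (K : set (borel_rV R n))) (f x)%:E = d%:E)%E ->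
  (mu A <= (c^-1 * d)%:E)%E.
Proof.
move=> cK cf mA AK f0 fc c0 fd.
have mK : measurable (K : set (borel_rV R n)).
  by apply: closed_borel; exact: compact_closed.
have mf B : @measurable_fun _ _ (borel_rV R n) (\bar R) B (EFin \o f).
  by apply/measurable_EFinP; exact: measurable_funTS (continuous_borel cf).
have : (c%:E * mu A <= d%:E)%E.
  rewrite -fd -(integral_cst mu mA c%:E).
  apply: (@le_trans _ _ (\int[mu]_(x in (A : set (borel_rV R n))) (f x)%:E)%E).
    apply: ge0_le_integral => //.
    by move=> x _; rewrite lee_fin ltW.
  apply: ge0_subset_integral => //; exact: (mf K).
by rewrite mulrC EFinM lee_pdivlMr// muleC.
Qed.
End borel.

(** * Harmonic measure on a compact set *)

Section seq.
Variables (R : realType) (n : nat).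
Implicit Types (A K : set 'rV[R]_n) (f : 'rV[R]_n -> R).

Lemma converging_to_nested K (U : nat -> set 'rV[R]_n) j k : converging_to K U ->
  (j <= k)%N -> U k `<=` U j.
Proof.
move=> [_ _ cU _] /subnK <-; elim: (k - j)%N => // m IH x Ux.
by apply/IH/cU; exact: subset_closure.
Qed.

(** For large [i], [g] is harmonic on [U i] and continuous up to its boundary, so its
    integral against [om i] is constantly [g z]. Weak convergence only speaks of
    functions continuous on the whole space, whence the extension [k]. *)
Lemma integral_harmonic K (U : nat -> set 'rV[R]_n)
    (om : nat -> probability (borel_rV R n) R)
    (mu : probability (borel_rV R n) R) z j f g : compact K -> K z ->
  converging_to K U ->
  (forall j, harmonic_measure_open (U j) z (om j)) ->
  (forall f : 'rV[R]_n -> R, continuous f ->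
     (\int[om j]_(x in boundary (U j)) (f x)%:E)%E @[j --> \oo]
          --> (\int[mu]_(x in K) (f x)%:E)%E) ->
  dirichlet_solution (U j) f g ->
  exists2 k : 'rV[R]_n -> R, continuous k /\ (forall y, K y -> k y = g y) &
    (\int[mu]_(x in K) (k x)%:E)%E = (g z)%:E.
Proof.
move=> cK Kz cU hom hmu [cg hg bg].
have [rU KU clU _] := cU.
have [bU oU _] := rU j.+1.
have [|||k ck kg] := @within_extension R n (closure (U j.+1)) g.
- exact: closed_closure.
- exact: compact_bounded (bounded_closure_compact bU).
- apply: continuous_subspaceW cg => y /clU; exact: subset_closure.
exists k.
  by split=> // y Ky; apply/kg/subset_closure/KU.
apply: (@cvg_unique _ (@ereal_hausdorff R)
  (\int[om i]_(x in boundary (U i)) (k x)%:E @[i --> \oo])%E).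
  exact: hmu.
apply: (@cvg_trans _ ((fun=> (g z)%:E) @ \oo)); last exact: cvg_cst.
apply: near_eq_cvg; near=> i.
have ji : (j.+1 <= i)%N by near: i; exact: nbhs_infty_ge.
have UiU : U i `<=` U j.+1 := converging_to_nested cU ji.
have UiUj : U i `<=` U j := converging_to_nested cU (ltnW ji).
apply: (hom i).2; first exact: continuous_subspaceT.
split.
- by apply: continuous_subspaceW cg; exact: closureS.
- by move=> y /UiUj; exact: hg.
- by move=> y [By _]; rewrite kg//; exact: closureS By.
Unshelve. all: by end_near. Qed.

End seq.

Theorem corollary5p3 (R : realType) (n : nat) (hn : (2 <= n)%N)
    (K : set 'rV[R]_n) (hK : compact K) (z : 'rV[R]_n) (hz : K z)
    (omega : probability (borel_rV R n) R)
    (homega : harmonic_measure K z omega) :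
  concentrated K omega (fine_boundary K).
Proof.
have n0 : (0 < n)%N by exact: leq_trans hn.
case: homega => _ [U [om [cU hom hmu]]].
move=> F mF FK.
have [rU KU clU _] := cU.
have bU0 : bounded_set (U 0%N) by have [] := rU 0%N.
have cq : continuous (@dist2 R n 0) by exact: dist2_continuous.
have /choice[g gP] : forall j, exists g, dirichlet_solution (U j) (dist2 0) g.
  by move=> j; have [_ _] := rU j; apply; exact: continuous_subspaceT.
have /choice[k kP] : forall j, exists k : 'rV[R]_n -> R,
    [/\ continuous k, forall y, K y -> k y = g j y &
    (\int[omega]_(x in K) (k x)%:E)%E = (g j z)%:E].
  move=> j; have [k [ck kg] ik] := integral_harmonic hK hz cU hom hmu (gP j).
  by exists k.
have iq := compact_integrable omega hK cq.
have [Q iQ] : exists Q : R, (\int[omega]_(x in K) (dist2 0 x)%:E)%E = Q%:E.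
  exists (fine (\int[omega]_(x in K) (dist2 0 x)%:E)%E); rewrite fineK//.
  by apply: integrable_fin_num iq; apply: closed_borel; exact: compact_closed.
have gQ : g j z @[j --> \oo] --> Q.
  suff /fine_cvg : (g j z)%:E @[j --> \oo] --> Q%:E by [].
  have := hmu _ cq; rewrite iQ; apply: cvg_trans; apply: near_eq_cvg.
  near=> j; apply/esym.
  by apply: ((hom j).2 _ _ _ (gP j)); exact: continuous_subspaceT.
have gq j y : K y -> dist2 0 y <= g j y.
  have [bU oU _] := rU j.
  by move=> Ky; apply: (dirichlet_dist2_ge n0 bU oU (gP j)); exact: KU.
have i_gap j : (\int[omega]_(x in K) (k j x - dist2 0 x)%:E)%E = (g j z - Q)%:E.
  have [ck _ ik] := kP j.
  rewrite EFinB -ik -iQ -integralB_EFin//.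
    by apply: closed_borel; exact: compact_closed.
  exact: compact_integrable.
(* the set where all the gaps stay above the positive constant of index [m] *)
pose E (m : nat) := K `&` \bigcap_j [set y | m.+1%:R^-1 <= k j y - dist2 0 y].
have ckq j : continuous (fun y => k j y - dist2 0 y).
  by have [ck _ _] := kP j; move=> y; exact: cvgB (ck y) (cq y).
have mE m : measurable (E m : set (borel_rV R n)).
  apply: closed_borel; apply: closedI; first exact: compact_closed.
  apply: closed_bigI => j _.
  apply: (@closed_comp _ _ (fun y => k j y - dist2 0 y) [set t | m.+1%:R^-1 <= t]).
    by move=> y _; exact: ckq.
  exact: closed_ge.
have E0 m : omega (E m) = 0%E.
  have bnd j : (omega (E m) <= (m.+1%:R^-1^-1 * (g j z - Q))%:E)%E.
    apply: markov_compact hK (ckq j) (mE m) _ _ _ _ (i_gap j).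
    - exact: subIsetl.
    - by move=> y Ky; have [_ kg _] := kP j; rewrite kg// subr_ge0 gq.
    - by move=> y [_ /(_ j I)].
    - by rewrite invr_gt0.
  apply/eqP; rewrite eq_le measure_ge0 andbT.
  have ff : omega (E m) \is a fin_num by exact: fin_num_measure.
  rewrite -(fineK ff) lee_fin.
  have -> : 0 = m.+1%:R^-1^-1 * (Q - Q) :> R by rewrite subrr mulr0.
  have cv : m.+1%:R^-1^-1 * (g j z - Q) @[j --> \oo] --> m.+1%:R^-1^-1 * (Q - Q).
    by apply: cvgM; [exact: cvg_cst|apply: cvgB => //; exact: cvg_cst].
  apply: (cvgr_to_ge cv); near=> j.
  by rewrite -lee_fin (fineK ff).
have FE : F `<=` \bigcup_m E m.
  move=> x Fx; have [Kx nbx] := FK x Fx.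
  have iK : @interior (fine_topology R n) K x.
    apply: contrapT => niK; apply: nbx; split=> //.
    exact: (@subset_closure (fine_topology R n)).
  have [c c0 hc] := fine_interior_gap n0 bU0 iK.
  have [m mc] : exists m : nat, m.+1%:R^-1 <= c.
    exists (Num.truncn c^-1); rewrite invf_ple ?posrE//.
    by rewrite ltW// truncnS_gt.
  exists m => //; split=> // j _ /=.
  have [_ kg _] := kP j; rewrite kg//.
  have [_ oU _] := rU j.
  have := hc (U j) _ (rU j) (converging_to_nested cU (leq0n j)) (KU j)
    (dirichlet_dist2_shift x oU (gP j)).
  rewrite dist2xx mul1r add0r mulN1r; exact: le_trans.
apply/eqP; rewrite eq_le measure_ge0 andbT.
have mUE : measurable (\bigcup_m E m : set (borel_rV R n)).
  by apply: bigcupT_measurable.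
rewrite (le_trans (le_measure omega _ _ FE)) ?inE//.
have /negligibleP -> // : omega.-negligible (\bigcup_m E m).
apply: negligible_bigcup => m; apply/negligibleP => //; exact: E0.
Unshelve. all: by end_near. Qed.
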